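(* There exists an absolute constant $C>0$ such that the following holds. Let $J$ be any distribution of prediction-state pairs $(v,y)\in[0,1]\times\{0,1\}$, let $\varepsilon,\delta\in(0,1/3)$, let $T>C\varepsilon^{-2}\log(1/\delta)$ be an integer, and let $S$ be a sample of $T$ i.i.d. points $(v_1,y_1),\ldots,(v_T,y_T)$ from $J$. Then with probability at least $1-\delta$ over the randomness of $S$, $$|\ell_1\text{-}\mathrm{ATB}(J_S)-\ell_1\text{-}\mathrm{ATB}(J)|\le\varepsilon\quad\text{and}\quad|\mathrm{ATB}(J_S)-\mathrm{ATB}(J)|\le\varepsilon.$$
   Context: $J_S$ denotes the (empirical) uniform distribution over the sample $S$. For a distribution $J$ of $(v,y)\in[0,1]\times\{0,1\}$, $$\mathrm{ATB}(J)=\mathbb E_{q\sim\mathrm{Unif}([0,1])}\Big[\big(\mathbb E_J[(v-y)\mathbb I[v<q]]\big)^2+\big(\mathbb E_J[(v-y)\mathbb I[v\ge q]]\big)^2\Big],$$ $$\ell_1\text{-}\mathrm{ATB}(J)=\mathbb E_{q\sim\mathrm{Unif}([0,1])}\Big[\big|\mathbb E_J[(v-y)\mathbb I[v<q]]\big|+\big|\mathbb E_J[(v-y)\mathbb I[v\ge q]]\big|\Big].$$ *)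

(* Defs.v *)
From HB Require Import structures.
From mathcomp Require Import all_boot all_order all_algebra.
From mathcomp Require Import all_classical all_reals all_analysis.

Set Implicit Arguments.
Unset Strict Implicit.
Unset Printing Implicit Defensive.
Import Order.TTheory GRing.Theory Num.Theory.
Import numFieldNormedType.Exports.

Local Open Scope classical_set_scope.
Local Open Scope ring_scope.

(* The expectation functionals below take an arbitrary measure J on R * bool,
   so that they apply both to a probability and to an empirical measure.  The
   state y is a boolean, read as the number 0 or 1; the constraint
   0 <= v <= 1 is imposed on J in [prediction_state_distribution]. *)

Definition residual (R : realType) (p : R * bool) : R := p.1 - p.2%:R.

Definition bias_below (R : realType)
    (J : {measure set (R * bool)%type -> \bar R}) (q : R) : R :=
  \int[J]_p (residual p * ((p : R * bool).1 < q)%R%:R).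

Definition bias_above (R : realType)
    (J : {measure set (R * bool)%type -> \bar R}) (q : R) : R :=
  \int[J]_p (residual p * (q <= (p : R * bool).1)%R%:R).

Definition ATB (R : realType)
    (J : {measure set (R * bool)%type -> \bar R}) : R :=
  \int[uniform_prob (@ltr01 R)]_q (bias_below J q ^+ 2 + bias_above J q ^+ 2).

Definition l1_ATB (R : realType)
    (J : {measure set (R * bool)%type -> \bar R}) : R :=
  \int[uniform_prob (@ltr01 R)]_q (`|bias_below J q| + `|bias_above J q|).

Definition prediction_state_distribution (R : realType)
    (J : probability (R * bool)%type R) : Prop :=
  J [set p : R * bool | 0 <= p.1 <= 1] = 1%E.

Section empirical.
Local Open Scope ereal_scope.
Context d (Z : measurableType d) (R : realType) (T : nat) (s : 'I_T -> Z).

(* A probability when 0 < T, see [empirical_setT]; for T = 0 it is the zero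
   measure. *)
Definition empirical (A : set Z) : \bar R :=
  (T%:R^-1)%:E * \sum_(i < T) \d_(s i) A.

Let empirical0 : empirical set0 = 0.
Proof. by rewrite /empirical big1 ?mule0. Qed.

Let empirical_ge0 A : 0 <= empirical A.
Proof.
by rewrite /empirical mule_ge0 ?lee_fin ?invr_ge0 ?ler0n// sume_ge0.
Qed.

Let empirical_sigma_additive : semi_sigma_additive empirical.
Proof.
move=> F mF tF mUF; rewrite /empirical.
have -> : (fun n => \sum_(0 <= k < n) ((T%:R^-1)%:E *
      \sum_(i < T) (\d_(s i) : set Z -> \bar R) (F k))) =
    (fun n => (T%:R^-1)%:E *
      \sum_(i < T) \sum_(0 <= k < n) (\d_(s i) : set Z -> \bar R) (F k)).
  apply/funext => n; rewrite -ge0_sume_distrr; last first.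
    by move=> k _; rewrite sume_ge0.
  by rewrite exchange_big.
apply: cvgeZl => //; apply: cvg_nnesum.
  by move=> i _; near=> n; rewrite sume_ge0.
by move=> i _; exact: measure_semi_sigma_additive.
Unshelve. all: by end_near.
Qed.

HB.instance Definition _ := isMeasure.Build _ _ _ empirical
  empirical0 empirical_ge0 empirical_sigma_additive.

Lemma empirical_setT : (0 < T)%N -> empirical [set: Z] = 1.
Proof.
move=> T0; rewrite /empirical.
under eq_bigr do rewrite diracT.
rewrite sumEFin sumr_const card_ord -EFinM mulVf// pnatr_eq0.
by rewrite -lt0n.
Qed.

End empirical.
Arguments empirical {d Z} R {T} s.

Definition mutually_independent d (Omega : measurableType d) (R : realType)
    (P : probability Omega R) d' (Z : measurableType d') (n : nat)
    (X : 'I_n -> {RV P >-> Z}) : Prop :=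
  forall (K : {set 'I_n}) (A : 'I_n -> set Z),
    (forall i, i \in K -> measurable (A i)) ->
    P (\bigcap_(i in [set` K]) (X i @^-1` A i)) =
    (\prod_(i in K) P (X i @^-1` A i))%E.

Definition iid_sample d (Omega : measurableType d) (R : realType)
    (P : probability Omega R) d' (Z : measurableType d')
    (J : probability Z R) (n : nat) (X : 'I_n -> {RV P >-> Z}) : Prop :=
  mutually_independent X /\
  forall i A, measurable A -> distribution P (X i) A = J A.

(* Main.v *)
Require Import Defs.
From mathcomp Require Import all_boot all_order all_algebra.
From mathcomp Require Import all_classical all_reals all_analysis.
From mathcomp Require Import measurable_realfun ring lra.

Set Implicit Arguments.
Unset Strict Implicit.
Unset Printing Implicit Defensive.
Import Order.TTheory GRing.Theory Num.Theory.
Import numFieldNormedType.Exports.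

Local Open Scope classical_set_scope.
Local Open Scope ring_scope.

(** Both quantities average over q, so no bound uniform in q is needed.  For
    each fixed q the empirical bias is a mean of iid terms bounded by 1 and
    Chernoff's bound controls [E exp(s |S_q|)], where [S_q] is the centred sum.
    Markov's inequality applied to the average over q of [exp(s (|S_q| - T t))],
    with Tonelli, then gives the same tail for the average deviation.  Both
    functionals move by at most twice the average deviations of the two biases,
    which are bounded by 1. *)

(** * Extension from indicators to nonnegative functions of a random variable *)

Section integral_mul_comp.
Context d (Omega : measurableType d) (R : realType)
  (P : {measure set Omega -> \bar R}) d' (Z : measurableType d')
  (Y : {mfun Omega >-> Z}).

Import HBNNSimple.

(** A simple function is the finite sum of its values times the indicators of its fibres.
    Nonnegativity allows integrating term by term without integrability of [h]. *)
Lemma integral_mul_nnsfun_comp (h : Omega -> R) (g : {nnsfun Z >-> R}) :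
  measurable_fun setT h -> (forall w, 0 <= h w) ->
  (\int[P]_w (h w * g (Y w))%:E =
   \sum_(r \in range g)
     (r%:E * \int[P]_w (h w * \1_(g @^-1` [set r]) (Y w))%:E))%E.
Proof.
move=> mh h0.
have mterm r : measurable_fun [set: Omega]
    (fun w => (h w * \1_(g @^-1` [set r]) (Y w))%:E).
  apply/measurable_EFinP; apply: measurable_funM => //.
  exact: measurableT_comp.
have term0 r w : (0 <= (h w * \1_(g @^-1` [set r]) (Y w))%:E)%E.
  by rewrite lee_fin mulr_ge0.
under eq_integral => w _.
  rewrite (_ : (_ * _)%:E = (\sum_(r \in range g)
      (r%:E * (h w * \1_(g @^-1` [set r]) (Y w))%:E))%E); last first.
    under eq_fsbigr do rewrite -EFinM mulrCA.
    by rewrite fsumEFin// -mulr_fsumr// -fimfunE.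
  over.
rewrite ge0_integral_fsum//=; last 2 first.
- by move=> r; exact: measurable_funeM.
- move=> r w _; have [[z _ <-]|nr] := pselect (range g r).
    by apply: mule_ge0 => //; rewrite lee_fin.
  rewrite -EFinM indicE memNset ?mulr0//= => gYr.
  by apply: nr; exists (Y w).
apply: eq_fsbigr => r /[!inE] -[z _ <-].
by rewrite ge0_integralZl// lee_fin.
Qed.

(* With [h2] constant, this is [E (h * g(Y)) = E h * E g(Y)] for all [g] from
   the case of indicators. *)
Lemma eq_integral_mul_comp (h1 h2 : Omega -> R) (g : Z -> R) :
  measurable_fun setT h1 -> (forall w, 0 <= h1 w) ->
  measurable_fun setT h2 -> (forall w, 0 <= h2 w) ->
  measurable_fun setT g -> (forall z, 0 <= g z) ->
  (forall A, measurable A -> \int[P]_w (h1 w * \1_A (Y w))%:E =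
                             \int[P]_w (h2 w * \1_A (Y w))%:E)%E ->
  (\int[P]_w (h1 w * g (Y w))%:E = \int[P]_w (h2 w * g (Y w))%:E)%E.
Proof.
move=> mh1 h10 mh2 h20 mg g0 h12.
have mEg : measurable_fun setT (EFin \o g) by exact/measurable_EFinP.
pose f := nnsfun_approx measurableT mEg.
(* Monotone convergence along the simple approximations of [g]. For [h1] and [h2] the two
   approximating sequences coincide termwise, so their limits do. *)
have lim_f (h : Omega -> R) : measurable_fun setT h -> (forall w, 0 <= h w) ->
    (\int[P]_w (h w * f n (Y w))%:E)%E @[n --> \oo] -->
    (\int[P]_w (h w * g (Y w))%:E)%E.
  move=> mh h0.
  have -> : (\int[P]_w (h w * g (Y w))%:E =
      \int[P]_w limn (fun n => (h w * f n (Y w))%:E))%E.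
    apply: eq_integral => w _; apply/esym/cvg_lim => //.
    under eq_fun do rewrite EFinM.
    rewrite EFinM; apply: cvgeZl => //.
    by apply: (cvg_nnsfun_approx measurableT mEg) => // z _; rewrite lee_fin.
  apply: cvg_monotone_convergence => //.
  - move=> n; apply/measurable_EFinP; apply: measurable_funM => //.
    exact: measurableT_comp.
  - by move=> n w _; rewrite lee_fin mulr_ge0.
  - move=> w _ m n mn; rewrite lee_fin ler_wpM2l//.
    exact/lefP/nd_nnsfun_approx.
have := lim_f _ mh1 h10.
under eq_fun => n.
  rewrite integral_mul_nnsfun_comp//.
  under eq_fsbigr do rewrite h12//.
  rewrite -integral_mul_nnsfun_comp//; over.
by move=> lim1; apply: (cvg_unique _ lim1 (lim_f _ mh2 h20)).
Qed.

End integral_mul_comp.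

Lemma probability_integrable_bounded d (T : measurableType d) (R : realType)
    (P : probability T R) (f : T -> R) (M : R) :
  measurable_fun [set: T] f -> (forall x, `|f x| <= M) ->
  P.-integrable [set: T] (EFin \o f).
Proof.
move=> mf fM; apply: measurable_bounded_integrable => //.
  exact: (le_lt_trans (probability_le1 P measurableT) (ltry 1)).
by exists M; split; [exact: num_real|move=> y My x _; exact: le_trans (ltW My)].
Qed.

(** * Expectation of a product of functions of independent variables *)

Section expectation_prod.
Context d (Omega : measurableType d) (R : realType) (P : probability Omega R)
  d' (Z : measurableType d') (n : nat) (X : 'I_n -> {RV P >-> Z}).
Hypothesis indepX : mutually_independent X.

(** A product of indicators is the indicator of the intersection of the preimages, and independence
    over the full index set factors its probability. *)
Let expectation_prod_indic (A : 'I_n -> set Z) :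
  (forall i, measurable (A i)) ->
  (\int[P]_w (\prod_(i < n) \1_(A i) (X i w))%:E =
   \prod_(i < n) \int[P]_w (\1_(A i) (X i w))%:E)%E.
Proof.
move=> mA.
have mXA i : measurable (X i @^-1` A i).
  by rewrite -[_ @^-1` _]setTI; exact: measurable_funP.
have -> : (\prod_(i < n) \int[P]_w (\1_(A i) (X i w))%:E =
           \prod_(i in [set: 'I_n]%SET) P (X i @^-1` A i))%E.
  apply: eq_big => [i|i _]; first by rewrite inE.
  by rewrite -[in RHS](setIT (X i @^-1` A i)) -integral_indic.
rewrite -indepX//.
have -> : \bigcap_(i in [set` [set: 'I_n]%SET]) (X i @^-1` A i) =
          \bigcap_(i in [set: 'I_n]) (X i @^-1` A i).
  by congr bigcap; apply/seteqP; split => i _ //=; rewrite inE.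
rewrite -[X in P X]setIT -integral_indic//; last first.
  by apply: fin_bigcap_measurable => //; exact: finite_finset.
apply: eq_integral => w _; congr EFin.
have [wA|nwA] := pselect ((\bigcap_(i in [set: 'I_n]) (X i @^-1` A i)) w).
  rewrite indicE mem_set// big1// => i _.
  by rewrite indicE mem_set//; exact: wA.
rewrite [RHS]indicE memNset//.
have [i nA] : exists i, ~ A i (X i w).
  by apply/existsNP => wA; apply: nwA => i _; exact: wA.
by rewrite (bigD1 i)//= indicE memNset// mul0r.
Qed.

Lemma expectation_prod (g : 'I_n -> Z -> R) (M : 'I_n -> R) :
  (forall i, measurable_fun setT (g i)) -> (forall i z, 0 <= g i z <= M i) ->
  (\int[P]_w (\prod_(i < n) g i (X i w))%:E =
   \prod_(i < n) \int[P]_w (g i (X i w))%:E)%E.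
Proof.
(* The first [k] functions are arbitrary, the others are indicators. *)
suff H k (f : 'I_n -> Z -> R) (B : 'I_n -> R) :
    (forall i, measurable_fun setT (f i)) -> (forall i z, 0 <= f i z <= B i) ->
    (forall i : 'I_n, (k <= i)%N -> exists2 A, measurable A & f i = \1_A) ->
    (\int[P]_w (\prod_(i < n) f i (X i w))%:E =
     \prod_(i < n) \int[P]_w (f i (X i w))%:E)%E.
  (* At [k = n] no index is left that has to carry an indicator. *)
  move=> mg gM; apply: (H n g M) => // i.
  by rewrite leqNgt ltn_ord.
elim: k f B => [|k IH] f B mf fB fA.
  have /choice[A HA] : forall i, exists A, measurable A /\ f i = \1_A.
    by move=> i; have [A mA fiE] := fA i isT; exists A.
  under eq_integral do under eq_bigr do rewrite (HA _).2.
  under [RHS]eq_bigr do under eq_integral do rewrite (HA _).2.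
  by apply: expectation_prod_indic => i; exact: (HA i).1.
(* If [n <= k], position [k] does not exist and the induction hypothesis already applies; otherwise
   [j], of value [k], is the position to free. *)
have [nk|kn] := leqP n k.
  apply: (IH _ B) => // i ki; have := ltn_ord i.
  by rewrite ltnNge (leq_trans nk ki).
pose j := Ordinal kn.
have f0 i z : 0 <= f i z by have /andP[] := fB i z.
have fXint i : P.-integrable setT (EFin \o (f i \o X i)).
  apply: (@probability_integrable_bounded _ _ _ _ _ (B i)).
    exact: measurableT_comp.
  by move=> w; rewrite ger0_norm//=; have /andP[] := fB i (X i w).
(* [h] collects the other factors and [c] the product of their means. It remains to replace [h] by
   [c] against [f j (X j)], which [eq_integral_mul_comp] reduces to indicators of [X j]. *)
pose c := \prod_(i < n | i != j) fine (\int[P]_w (f i (X i w))%:E)%E.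
pose h w := \prod_(i < n | i != j) f i (X i w).
have c0 : 0 <= c.
  apply: prodr_ge0 => i _; apply: fine_ge0; apply: integral_ge0 => w _.
  by rewrite lee_fin.
have cE : c%:E = (\prod_(i < n | i != j) \int[P]_w (f i (X i w))%:E)%E.
  rewrite /c -prodEFin; apply: eq_bigr => i _.
  by rewrite fineK//; exact: (integrable_fin_num measurableT (fXint i)).
rewrite (bigD1 j)//= -cE muleC -ge0_integralZl//; last 2 first.
- by apply/measurable_EFinP; exact: measurableT_comp.
- by move=> w _; rewrite lee_fin.
transitivity (\int[P]_w (h w * f j (X j w))%:E)%E.
  by apply: eq_integral => w _; rewrite (bigD1 j)//= mulrC.
under [RHS]eq_integral do rewrite -EFinM.
apply: eq_integral_mul_comp => //.
- rewrite /h; under eq_fun do rewrite big_mkcond/=.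
  apply: measurable_prod => i _; case: (i != j) => //.
  exact: measurableT_comp.
- by move=> w; apply: prodr_ge0.
move=> A mA.
(* With an indicator at [j], all positions from [k] on carry indicators, as the induction hypothesis
   demands. *)
pose f' i := if i == j then \1_A else f i.
have f'j : f' j = \1_A by rewrite /f' eqxx.
have f'E i : i != j -> f' i = f i by rewrite /f' => /negbTE ->.
transitivity (\int[P]_w (\prod_(i < n) f' i (X i w))%:E)%E.
  apply: eq_integral => w _.
  rewrite (bigD1 j)//= f'j mulrC; congr (_ * _)%:E.
  by apply: eq_bigr => i ij; rewrite f'E.
rewrite (IH f' (fun i => if i == j then 1 else B i)).
- rewrite (bigD1 j)//= f'j muleC.
  rewrite [X in (X * _)%E](_ : _ = c%:E); last first.
    by rewrite cE; apply: eq_bigr => i ij; rewrite f'E.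
  rewrite -ge0_integralZl//.
  by apply/measurable_EFinP; exact: measurableT_comp.
- by move=> i; rewrite /f'; case: eqP.
- move=> i z; rewrite /f'; case: eqP => // _.
  by rewrite indicE; case: (_ \in _); rewrite ?ler01 ?lexx.
- move=> i ki; rewrite /f'; case: eqP => [_|/eqP ij]; first by exists A.
  apply: fA; rewrite ltn_neqAle ki andbT; apply: contra_neq ij => kE.
  exact: val_inj.
Qed.

End expectation_prod.

Lemma Rintegral_probability_cst d (T : measurableType d) (R : realType)
    (P : probability T R) (r : R) : \int[P]_x r = r.
Proof.
transitivity (r * fine (P setT)); first exact: Rintegral_cst.
by rewrite (probability_setT P) mulr1.
Qed.

Lemma probability_mean_le1 d (T : measurableType d) (R : realType)
    (P : probability T R) (f : T -> R) :
  measurable_fun [set: T] f -> (forall x, `|f x| <= 1) ->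
  `|\int[P]_x f x| <= 1.
Proof.
move=> mf f1; have intf := probability_integrable_bounded P mf f1.
apply: (le_trans (le_normr_Rintegral measurableT intf)).
rewrite -[leRHS](Rintegral_probability_cst P); apply: le_Rintegral => //.
  exact: (integrable_norm intf).
by apply: (@probability_integrable_bounded _ _ _ _ _ 1) => // x; rewrite normr1.
Qed.

(** From [expR (- x) >= 1 - x] one gets [expR x <= (1 - x)^-1], and [(1 - x) * (1 + x + 2 * x ^+ 2)
    = 1 + x ^+ 2 * (1 - 2 * x)] is at least 1. *)
Lemma expR_le_quadratic (R : realType) (x : R) :
  x <= 1 / 2 -> expR x <= 1 + x + 2 * x ^+ 2.
Proof.
move=> x2; rewrite -[x in expR x]opprK expRN.
have x1 : 0 < 1 - x by lra.
apply: (@le_trans _ _ (1 - x)^-1).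
  by rewrite lef_pV2 ?posrE ?expR_gt0// expR_ge1Dx.
rewrite -[leLHS]mul1r ler_pdivrMr//.
have : 0 <= x ^+ 2 * (1 - 2 * x) by rewrite mulr_ge0 ?sqr_ge0//; lra.
nra.
Qed.

(** * Exponential moments of centred iid sums *)

Section chernoff.
Context d' (Z : measurableType d') (R : realType) (J : probability Z R)
  (g : Z -> R).
Hypotheses (mg : measurable_fun [set: Z] g) (g1 : forall z, `|g z| <= 1).

Let mu := \int[J]_z g z.

Let integrable_g : J.-integrable setT (EFin \o g).
Proof. exact: probability_integrable_bounded mg g1. Qed.

Let mean_le1 : `|mu| <= 1. Proof. exact: probability_mean_le1. Qed.

Let deviation_le2 z : `|g z - mu| <= 2.
Proof.
by rewrite (le_trans (ler_normB _ _))// (le_trans (lerD (g1 z) mean_le1)).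
Qed.

Let scaled_deviation_le s z : `|s| <= 1 / 4 -> s * (g z - mu) <= 1 / 2.
Proof.
move=> s4; apply: (le_trans (ler_norm _)); rewrite normrM.
by have := ler_pM (normr_ge0 _) (normr_ge0 _) s4 (deviation_le2 z); lra.
Qed.

Let mexp s : measurable_fun [set: Z] (fun z => expR (s * (g z - mu))).
Proof.
apply: measurableT_comp => //; apply: measurable_funM => //.
exact: measurable_funB.
Qed.

Let exp_bounds s z : `|s| <= 1 / 4 ->
  0 <= expR (s * (g z - mu)) <= expR (1 / 2).
Proof. by move=> s4; rewrite expR_ge0 ler_expR scaled_deviation_le. Qed.

(** The deviation of [g] from its mean is at most 2, so the exponent stays below 1/2 and the
    quadratic bound applies. The linear term integrates to 0, the quadratic one is at most
    [2 * s ^+ 2 * 4], and [1 + x <= expR x] concludes. *)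
Lemma mgf_centered_le s : `|s| <= 1 / 4 ->
  (\int[J]_z (expR (s * (g z - mu)))%:E <= (expR (8 * s ^+ 2))%:E)%E.
Proof.
move=> s4.
have int_lin c : J.-integrable setT (EFin \o (fun z => s * g z + c)).
  apply: (@probability_integrable_bounded _ _ _ _ _ (`|s| + `|c|)).
    by apply: measurable_funD => //; exact: measurable_funM.
  move=> z; rewrite (le_trans (ler_normD _ _))// lerD2r normrM.
  by rewrite ler_piMr.
pose c := 1 - s * mu + 8 * s ^+ 2.
apply: (@le_trans _ _ (\int[J]_z (s * g z + c)%:E)%E).
  apply: ge0_le_integral => //.
  - exact/measurable_EFinP.
  - exact: measurable_int (int_lin c).
  - move=> z _; rewrite lee_fin.
    apply: (le_trans (expR_le_quadratic (scaled_deviation_le z s4))).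
    have : (g z - mu) ^+ 2 <= 4.
      have := ler_pM (normr_ge0 _) (normr_ge0 _) (deviation_le2 z)
        (deviation_le2 z).
      by rewrite -normrM -expr2 ger0_norm ?sqr_ge0//; lra.
    move/(ler_wpM2l (sqr_ge0 s)); rewrite /c; nra.
rewrite -[leLHS]fineK; last exact: (integrable_fin_num measurableT (int_lin c)).
rewrite lee_fin -[fine _]/(\int[J]_z (s * g z + c)) RintegralD//; last 2 first.
- have -> : (EFin \o (fun z => s * g z)) = (EFin \o (fun z => s * g z + 0)).
    by apply/funext => z /=; rewrite addr0.
  exact: int_lin.
- apply: (@probability_integrable_bounded _ _ _ _ _ `|c|) => //.
rewrite RintegralZl// Rintegral_probability_cst -/mu.
apply: le_trans (expR_ge1Dx _); rewrite /c; lra.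
Qed.

Context d (Omega : measurableType d) (P : probability Omega R) (n : nat)
  (X : 'I_n -> {RV P >-> Z}).
Hypothesis iidX : iid_sample J X.

(** The exponential of the sum is a product of functions of the independent [X i], so its
    expectation is the [n]-th power of the moment of one term. *)
Lemma mgf_sum_le s : `|s| <= 1 / 4 ->
  (\int[P]_w (expR (s * \sum_(i < n) (g (X i w) - mu)))%:E <=
   (expR (8 * s ^+ 2 * n%:R))%:E)%E.
Proof.
move=> s4.
have intJ : J.-integrable setT (EFin \o (fun z => expR (s * (g z - mu)))).
  apply: (@probability_integrable_bounded _ _ _ _ _ (expR (1 / 2))) => // z.
  by have /andP[e0 e1] := exp_bounds z s4; rewrite ger0_norm.
under eq_integral do rewrite mulr_sumr expR_sum.
rewrite (expectation_prod iidX.1 (g := fun _ z => expR (s * (g z - mu)))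
  (M := fun=> expR (1 / 2)))//; last by move=> _ z; exact: exp_bounds.
pose r := \int[J]_z expR (s * (g z - mu)).
rewrite (eq_bigr (fun=> r%:E)); last first.
  move=> i _; rewrite /r /Rintegral fineK//; last first.
    exact: (integrable_fin_num measurableT intJ).
  (* The law of [X i] is [J], so each factor can be computed under [J]. *)
  rewrite -(ge0_integral_distribution (X i)
    (f := fun z => (expR (s * (g z - mu)))%:E)).
  - by apply: eq_measure_integral => A mA _; exact: iidX.2.
  - exact/measurable_EFinP.
  - by move=> z; rewrite lee_fin expR_ge0.
rewrite prodEFin prodr_const card_ord lee_fin expRM_natr.
apply: lerXn2r; rewrite ?nnegrE ?expR_ge0//.
  by apply: Rintegral_ge0 => z _; exact: expR_ge0.
rewrite -lee_fin /r /Rintegral fineK; first exact: mgf_centered_le.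
exact: (integrable_fin_num measurableT intJ).
Qed.

(** The exponential of [s * |x|] is at most [expR (s * x) + expR (- s * x)]; the two signs account
    for the factor 2. *)
Lemma mgf_abs_sum_le s : 0 <= s <= 1 / 4 ->
  (\int[P]_w (expR (s * `|\sum_(i < n) (g (X i w) - mu)|))%:E <=
   (2 * expR (8 * s ^+ 2 * n%:R))%:E)%E.
Proof.
move=> /andP[s0 s4].
have mS : measurable_fun [set: Omega] (fun w => \sum_(i < n) (g (X i w) - mu)).
  apply: measurable_sum => i; apply: measurable_funB => //.
  exact: measurableT_comp.
have mE c : measurable_fun [set: Omega]
    (fun w => (expR (c * \sum_(i < n) (g (X i w) - mu)))%:E).
  apply/measurable_EFinP; apply: measurableT_comp => //.
  exact: measurable_funM.
apply: (@le_trans _ _ (\int[P]_w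
   ((expR (s * \sum_(i < n) (g (X i w) - mu)))%:E +
    (expR (- s * \sum_(i < n) (g (X i w) - mu)))%:E))%E).
  apply: ge0_le_integral => //.
  - apply/measurable_EFinP; apply: measurableT_comp => //.
    by apply: measurable_funM => //; exact: measurableT_comp.
  - exact: emeasurable_funD.
  - move=> w _; rewrite -EFinD lee_fin.
    case: (ger0P (\sum_(i < n) _)) => _.
      by rewrite lerDl expR_ge0.
    by rewrite mulrN -mulNr lerDr expR_ge0.
rewrite ge0_integralD//.
have s4' : `|s| <= 1 / 4 by rewrite ger0_norm.
have Ns4 : `|- s| <= 1 / 4 by rewrite normrN.
rewrite mulrDl !mul1r EFinD leeD//; first exact: mgf_sum_le.
by have := mgf_sum_le Ns4; rewrite sqrrN.
Qed.

End chernoff.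

(** * Tail of the deviation averaged over a parameter *)

Section integrated_deviation.
Context dZ (Z : measurableType dZ) (R : realType) (J : probability Z R)
  dY (Y : measurableType dY) (Q : probability Y R) (f : Z * Y -> R).
Hypotheses (mf : measurable_fun [set: Z * Y] f) (f1 : forall u, `|f u| <= 1).

Lemma measurable_section_mean :
  measurable_fun [set: Y] (fun q => \int[J]_z f (z, q)).
Proof.
apply: measurableT_comp => //.
apply: (measurable_fubini_G (m1 := J) (m2 := Q) (f := EFin \o f)).
exact: (@probability_integrable_bounded _ _ _ (J \x Q)%E f 1).
Qed.

Context d (Omega : measurableType d) (P : probability Omega R) (n : nat)
  (X : 'I_n -> {RV P >-> Z}).
Hypotheses (iidX : iid_sample J X) (n0 : (0 < n)%N).

(** The centred sum [S_q] at an outcome, taken as a function of both variables so that Tonelli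
    applies. *)
Let dev (u : Omega * Y) : R :=
  \sum_(i < n) (f (X i u.1, u.2) - \int[J]_z f (z, u.2)).

Let mdev : measurable_fun [set: Omega * Y] dev.
Proof.
apply: measurable_sum => i; apply: measurable_funB.
  apply: measurableT_comp => //; apply: measurable_fun_pair => //=.
  exact: measurableT_comp.
by apply: (measurableT_comp measurable_section_mean).
Qed.

Let mean_le1 q : `|\int[J]_z f (z, q)| <= 1.
Proof. by apply: probability_mean_le1 => //; exact: measurableT_comp. Qed.

Let dev_bounded u : `|dev u| <= n%:R * 2.
Proof.
apply: (le_trans (ler_norm_sum _ _ _)).
rewrite -[n in leRHS]card_ord mulr_natl -sumr_const.
apply: ler_sum => i _; apply: (le_trans (ler_normB _ _)).
by have := f1 (X i u.1, u.2); have := mean_le1 u.2; lra.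
Qed.

Let mdev_section w : measurable_fun [set: Y] (fun q => dev (w, q)).
Proof. exact: measurableT_comp. Qed.

Lemma measurable_integrated_deviation : measurable_fun [set: Omega]
  (fun w => \int[Q]_q `|n%:R^-1 * dev (w, q)|).
Proof.
apply: measurableT_comp => //.
apply: (@measurable_fun_fubini_tonelli_F _ _ _ _ _ Q
  (fun u => (`|n%:R^-1 * dev u|)%:E)) => //.
apply/measurable_EFinP; apply: measurableT_comp => //.
exact: measurable_funM.
Qed.

Lemma integrated_deviation_tail t : 0 <= t <= 4 ->
  (P [set w | t < \int[Q]_q `|n%:R^-1 * dev (w, q)|]%R <=
   (2 * expR (- (n%:R * t ^+ 2 / 32)))%:E)%E.
Proof.
move=> /andP[t0 t4].
have nR : 0 < n%:R :> R by rewrite ltr0n.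
set B := [set w | _]%R.
have mB : measurable B.
  rewrite -[B]setTI; apply: measurable_fun_ltr => //.
  exact: measurable_integrated_deviation.
(* This [s] minimises the Chernoff exponent [n * (8 * s ^+ 2 - s * t)], with value
   [- n * t ^+ 2 / 32]; [t <= 4] ensures [s <= 1 / 4]. *)
pose s := t / 16.
have s04 : 0 <= s <= 1 / 4 by rewrite /s; apply/andP; split; lra.
have /andP[s0 s4] := s04.
pose F (u : Omega * Y) := expR (s * (`|dev u| - n%:R * t)).
have mF : measurable_fun [set: Omega * Y] (EFin \o F).
  apply/measurable_EFinP; apply: measurableT_comp => //.
  apply: measurable_funM => //; apply: measurable_funB => //.
  exact: measurableT_comp.
have F0 u : (0 <= (EFin \o F) u)%E by rewrite lee_fin expR_ge0.
(* Markov's inequality: the average of [F] over [q] is at least 1 on [B] and nonnegative elsewhere,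
   so it dominates the indicator of [B]. *)
apply: (@le_trans _ _ (\int[P]_w \int[Q]_q (EFin \o F) (w, q))%E).
  rewrite -[B]setIT -integral_indic//; apply: ge0_le_integral => //.
  - exact/measurable_EFinP.
  - exact: (@measurable_fun_fubini_tonelli_F _ _ _ _ _ Q _ mF).
  move=> w _; have [wB|nwB] := pselect (B w); last first.
    by rewrite indicE memNset// integral_ge0.
  rewrite indicE mem_set// mulr1n.
  have int_abs : Q.-integrable setT
      (EFin \o (fun q => `|n%:R^-1 * dev (w, q)|)).
    apply: (@probability_integrable_bounded _ _ _ _ _ 2).
      by apply: measurableT_comp => //; exact: measurable_funM.
    move=> q; rewrite normr_id normrM gtr0_norm ?invr_gt0//.
    by rewrite ler_pdivrMl.
  have int_cst (c : R) : Q.-integrable setT (EFin \o (fun _ : Y => c)).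
    exact: (@probability_integrable_bounded _ _ _ _ _ `|c|).
  have intZ : Q.-integrable setT
      (EFin \o (fun q => s * n%:R * `|n%:R^-1 * dev (w, q)|)).
    exact: (@integrableZl _ _ _ _ _ measurableT (s * n%:R) _ int_abs).
  have intlin : Q.-integrable setT (EFin \o
      (fun q => s * n%:R * `|n%:R^-1 * dev (w, q)| + (1 - s * n%:R * t))).
    exact: (@integrableD _ _ _ _ _ measurableT _ _ intZ (int_cst _)).
  (* [expR x >= 1 + x] plays the role of Jensen's inequality. *)
  apply: (@le_trans _ _ (\int[Q]_q
      (s * n%:R * `|n%:R^-1 * dev (w, q)| + (1 - s * n%:R * t))%:E)%E).
    rewrite -[leRHS]fineK; last exact: (integrable_fin_num measurableT intlin).
    rewrite lee_fin -[fine _]/(\int[Q]_q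
      (s * n%:R * `|n%:R^-1 * dev (w, q)| + (1 - s * n%:R * t))).
    rewrite RintegralD// RintegralZl// Rintegral_probability_cst.
    have := ler_wpM2l (mulr_ge0 s0 (ltW nR)) (ltW wB); lra.
  apply: le_integral => //.
    apply: (@probability_integrable_bounded _ _ _ _ _ (expR (s * (n%:R * 2)))).
      apply/measurable_EFinP.
      exact: (measurableT_comp mF (pair1_measurable w)).
    move=> q; rewrite ger0_norm ?expR_ge0// ler_expR ler_wpM2l//.
    have := dev_bounded (w, q); have : 0 <= n%:R * t by rewrite mulr_ge0// ltW.
    lra.
  move=> q _; rewrite lee_fin /F.
  apply: le_trans (expR_ge1Dx _); rewrite normrM ger0_norm ?invr_ge0 ?ler0n//.
  rewrite !mulrA mulfK ?gt_eqF//; lra.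
(* With [q] as the outer variable, the exponential moment bound applies at each fixed [q]. The right
   side becomes the integral of a constant over [Q], for a pointwise comparison. *)
rewrite (@fubini_tonelli _ _ _ _ _ P Q _ mF F0).
rewrite [leRHS](_ : _ = \int[Q]_q
    (2 * expR (- (n%:R * t ^+ 2 / 32)))%:E)%E; last first.
  transitivity ((2 * expR (- (n%:R * t ^+ 2 / 32)))%:E * Q setT)%E.
    by rewrite (probability_setT Q) mule1.
  by apply/esym; exact: integral_cst.
apply: ge0_le_integral => //.
- by move=> q _; apply: integral_ge0 => w _; exact: F0.
- exact: (@measurable_fun_fubini_tonelli_G _ _ _ _ _ P _ mF).
move=> q _.
have mfq : measurable_fun [set: Z] (fun z => f (z, q)).
  exact: measurableT_comp.
under eq_integral.
  move=> w _; rewrite /= /F mulrBr addrC expRD EFinM.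
  over.
rewrite ge0_integralZl//; last first.
  apply/measurable_EFinP; apply: measurableT_comp => //.
  apply: measurable_funM => //; apply: measurableT_comp => //.
  exact: (measurableT_comp mdev).
have f1q z : `|f (z, q)| <= 1 by [].
have := mgf_abs_sum_le mfq f1q iidX s04.
move/(lee_wpmul2l (x := (expR (- (s * (n%:R * t))))%:E)).
rewrite lee_fin expR_ge0 => /(_ isT) /le_trans; apply.
rewrite -EFinM lee_fin mulrCA -expRD ler_wpM2l// ler_expR /s.
lra.
Qed.

End integrated_deviation.

(** * Integrals under the empirical measure and comparison of averages *)

Lemma Rintegral_empirical d (Z : measurableType d) (R : realType) (n : nat)
    (s : 'I_n -> Z) (g : Z -> R) : measurable_fun [set: Z] g ->
  \int[empirical R s]_z g z = n%:R^-1 * \sum_(i < n) g (s i).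
Proof.
move=> mg.
(* [msum] takes a family indexed by all naturals, so the Dirac masses are extended by the zero
   measure from [n] on. *)
pose m k : {measure set Z -> \bar R} :=
  if insub k is Some i then \d_(s i) else mzero.
have ge0_case (h : Z -> R) : measurable_fun setT h -> (forall z, 0 <= h z) ->
    (\int[empirical R s]_z (h z)%:E = (n%:R^-1 * \sum_(i < n) h (s i))%:E)%E.
  move=> mh h0.
  have r0 : 0 <= n%:R^-1 :> R by rewrite invr_ge0.
  rewrite (eq_measure_integral (mscale (NngNum r0) (msum m n))); last first.
    move=> A mA _; rewrite /empirical/= /mscale/= /msum/=; congr (_ * _)%E.
    by apply: eq_bigr => i _; rewrite /m valK.
  rewrite ge0_integral_mscale//=;
    [|exact/measurable_EFinP|by move=> z _; rewrite lee_fin].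
  rewrite ge0_integral_measure_sum//;
    [|by move=> z _; rewrite lee_fin|exact/measurable_EFinP].
  rewrite EFinM -sumEFin; congr (_ * _)%E; apply: eq_bigr => i _.
  rewrite /m valK integral_dirac//; last exact/measurable_EFinP.
  by rewrite diracT mul1e.
rewrite /Rintegral integralE -/(EFin \o g) funerpos funerneg.
rewrite (ge0_case _ (measurable_funrpos mg) (funrpos_ge0 g)).
rewrite (ge0_case _ (measurable_funrneg mg) (funrneg_ge0 g)).
rewrite -EFinB /= -mulrBr -sumrB; congr (_ * _); apply: eq_bigr => i _.
by rewrite -[in RHS](funrposBneg g).
Qed.

(** Meant for [u] and [v] the deviations of the two biases and [x], [y] the integrands of a
    functional: each deviation contributes [2 * (e / 4)]. The bound [M] provides integrability. *)
Lemma Rintegral_dist_le (R : realType) dY (Y : measurableType dY)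
    (Q : probability Y R) (x y u v : Y -> R) (M e : R) :
  measurable_fun setT x -> measurable_fun setT y ->
  measurable_fun setT u -> measurable_fun setT v ->
  (forall q, `|x q| <= M) -> (forall q, `|y q| <= M) ->
  (forall q, `|u q| <= M) -> (forall q, `|v q| <= M) ->
  (forall q, `|x q - y q| <= 2 * `|u q| + 2 * `|v q|) ->
  \int[Q]_q `|u q| <= e / 4 -> \int[Q]_q `|v q| <= e / 4 ->
  `|\int[Q]_q x q - \int[Q]_q y q| <= e.
Proof.
move=> mx my mu mv xM yM uM vM xy ue ve.
have intM (f : Y -> R) : measurable_fun setT f -> (forall q, `|f q| <= M) ->
    Q.-integrable setT (EFin \o f).
  by move=> mf fM; exact: probability_integrable_bounded mf fM.
have intabs (f : Y -> R) : measurable_fun setT f -> (forall q, `|f q| <= M) ->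
    Q.-integrable setT (EFin \o (fun q => 2 * `|f q|)).
  move=> mf fM; apply: (@probability_integrable_bounded _ _ _ _ _ (2 * M)).
    by apply: measurable_funM => //; exact: measurableT_comp.
  by move=> q; rewrite normrM normr_id ger0_norm// ler_pM2l.
rewrite -RintegralB//; try exact: intM.
have intB : Q.-integrable setT (EFin \o (fun q => x q - y q)).
  exact: (@integrableB _ _ _ _ _ measurableT _ _ (intM _ mx xM) (intM _ my yM)).
apply: (le_trans (le_normr_Rintegral measurableT intB)).
apply: (@le_trans _ _ (\int[Q]_q (2 * `|u q| + 2 * `|v q|))).
  apply: le_Rintegral => //; first exact: (integrable_norm intB).
  exact: (@integrableD _ _ _ _ _ measurableT _ _ (intabs _ mu uM)
    (intabs _ mv vM)).
rewrite RintegralD//; try exact: intabs.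
rewrite !RintegralZl//; try exact: (integrable_norm (intM _ _ _)).
lra.
Qed.

Lemma measurable_unit_predictions (R : realType) :
  measurable [set p : R * bool | 0 <= p.1 <= 1].
Proof.
have mb : measurable_fun setT (fun p : R * bool => 0 <= p.1 <= 1).
  by apply: measurable_and; apply: measurable_fun_ler.
by rewrite -[X in measurable X]setTI; exact: (mb measurableT [set true]).
Qed.

(** * The two biases as instances of one masked mean *)

Section masked_residual.
Context (R : realType).
Implicit Type c : (R * bool) * R -> bool.

(** The selector [c] depends jointly on the point and the threshold, so that [v < q] and [q <= v]
    are treated at once. *)
Definition masked_residual c (u : (R * bool) * R) : R :=
  residual u.1 * (c u)%:R.

Definition masked_bias c (J : {measure set (R * bool) -> \bar R}) (q : R) : R :=
  \int[J]_p masked_residual c (p, q).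

(* Sample points outside [0,1] form a null event, but on it the residual is
   unbounded; the extra factor makes the summands bounded by 1 everywhere. *)
Definition unit_mask c (u : (R * bool) * R) : bool :=
  c u && (0 <= u.1.1 <= 1).

Let measurable_boolr d (T : measurableType d) (b : T -> bool) :
  measurable_fun setT b -> measurable_fun setT (fun x => (b x)%:R : R).
Proof.
move=> mb; rewrite (_ : (fun _ => _) = (fun x => if b x then 1 else 0)).
  exact: measurable_fun_ifT.
by apply/funext => x; case: (b x).
Qed.

Lemma measurable_masked_residual c : measurable_fun setT c ->
  measurable_fun [set: (R * bool) * R] (masked_residual c).
Proof.
move=> mc; apply: measurable_funM; last exact: measurable_boolr.
apply: measurable_funB; first exact: measurableT_comp.
by apply: measurable_boolr; exact: measurableT_comp.
Qed.

Lemma measurable_unit_mask c : measurable_fun setT c ->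
  measurable_fun [set: (R * bool) * R] (unit_mask c).
Proof.
move=> mc; apply: measurable_and => //; apply: measurable_and;
  apply: measurable_fun_ler => //; exact: measurableT_comp.
Qed.

Lemma masked_residual_unit_le1 c u : `|masked_residual (unit_mask c) u| <= 1.
Proof.
rewrite /masked_residual /unit_mask /residual.
case: (c u) => /=; last by rewrite mulr0 normr0.
case: (boolP (0 <= u.1.1 <= 1)) => [/andP[v0 v1]|_]; last first.
  by rewrite mulr0 normr0.
rewrite mulr1 ler_norml.
by case: u.1.2 => /=; lra.
Qed.

(** [J] gives full mass to predictions in [0,1], so the two integrands agree almost everywhere. *)
Lemma masked_bias_unit c (J : probability (R * bool)%type R) (q : R) :
  prediction_state_distribution J -> measurable_fun setT c ->
  masked_bias c J q = masked_bias (unit_mask c) J q.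
Proof.
move=> J01 mc; congr fine.
have mU := @measurable_unit_predictions R.
apply: ae_eq_integral => //.
- apply/measurable_EFinP.
  by apply: (measurableT_comp (measurable_masked_residual mc)).
- apply/measurable_EFinP.
  by apply: (measurableT_comp
    (measurable_masked_residual (measurable_unit_mask mc))).
exists (~` [set p : R * bool | 0 <= p.1 <= 1]); split.
- exact: measurableC.
- by rewrite [LHS](probability_setC J mU) J01 subee.
move=> p /= np p01; apply: np => _.
by rewrite /masked_residual /unit_mask/= p01 andbT.
Qed.

Lemma masked_bias_empirical c n (s : 'I_n -> R * bool) (q : R) :
  measurable_fun setT c ->
  masked_bias c (empirical R s) q =
  n%:R^-1 * \sum_(i < n) masked_residual c (s i, q).
Proof.
move=> mc; apply: Rintegral_empirical.
by apply: (measurableT_comp (measurable_masked_residual mc)).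
Qed.

End masked_residual.

(** * From bias deviations to deviations of the two functionals *)

Section ATB_deviation.
Context (R : realType).

Let Q : probability _ R := uniform_prob (@ltr01 R).
Let below (u : (R * bool) * R) : bool := u.1.1 < u.2.
Let above (u : (R * bool) * R) : bool := u.2 <= u.1.1.

Let mbelow : measurable_fun setT below.
Proof. by apply: measurable_fun_ltr => //; exact: measurableT_comp. Qed.

Let mabove : measurable_fun setT above.
Proof. by apply: measurable_fun_ler => //; exact: measurableT_comp. Qed.

Section population.
Context (J : probability (R * bool)%type R)
  (c : (R * bool) * R -> bool).
Hypotheses (J01 : prediction_state_distribution J)
  (mc : measurable_fun setT c).

(** The unit mask leaves the bias unchanged and makes the integrand bounded, hence integrable on the
    product space. *)
Lemma measurable_masked_bias : measurable_fun setT (masked_bias c J).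
Proof.
rewrite (_ : masked_bias c J = masked_bias (unit_mask c) J).
  apply: (measurable_section_mean J Q) => //.
    by apply: measurable_masked_residual; exact: measurable_unit_mask.
  exact: masked_residual_unit_le1.
by apply/funext => q; exact: masked_bias_unit.
Qed.

Lemma masked_bias_le1 q : `|masked_bias c J q| <= 1.
Proof.
rewrite masked_bias_unit//; apply: probability_mean_le1.
  apply: (measurableT_comp (measurable_masked_residual _)) => //.
  exact: measurable_unit_mask.
by move=> p; exact: masked_residual_unit_le1.
Qed.

End population.

Section empirical_bias.
Context (n : nat) (s : 'I_n -> R * bool) (c : (R * bool) * R -> bool).
Hypothesis mc : measurable_fun setT c.

Lemma measurable_masked_bias_empirical :
  measurable_fun setT (masked_bias c (empirical R s)).
Proof.
rewrite (_ : masked_bias c _ =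
    fun q => n%:R^-1 * \sum_(i < n) masked_residual c (s i, q)).
  apply: measurable_funM => //; apply: measurable_sum => i.
  by apply: (measurableT_comp (measurable_masked_residual mc)).
by apply/funext => q; exact: masked_bias_empirical.
Qed.

Hypothesis s01 : forall i, 0 <= (s i).1 <= 1.

Lemma masked_bias_empirical_unit q :
  masked_bias c (empirical R s) q =
  n%:R^-1 * \sum_(i < n) masked_residual (unit_mask c) (s i, q).
Proof.
rewrite masked_bias_empirical//; congr (_ * _); apply: eq_bigr => i _.
by rewrite /masked_residual /unit_mask/= s01 andbT.
Qed.

Lemma masked_bias_empirical_le1 q : (0 < n)%N ->
  `|masked_bias c (empirical R s) q| <= 1.
Proof.
move=> n0; rewrite masked_bias_empirical_unit normrM ger0_norm ?invr_ge0//.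
rewrite ler_pdivrMl ?ltr0n// mulr1.
apply: (le_trans (ler_norm_sum _ _ _)).
rewrite -[n in leRHS]card_ord -sumr_const.
by apply: ler_sum => i _; exact: masked_residual_unit_le1.
Qed.

End empirical_bias.

(** The absolute value is 1-Lipschitz and the square is 2-Lipschitz on [-1,1], where all biases lie.
    Both integrands thus move by at most twice the sum of the two bias deviations. *)
Lemma ATB_deviation_le (J : probability (R * bool)%type R) n
    (s : 'I_n -> R * bool) (e : R) :
  prediction_state_distribution J -> (0 < n)%N ->
  (forall i, 0 <= (s i).1 <= 1) ->
  \int[Q]_q `|bias_below (empirical R s) q - bias_below J q| <= e / 4 ->
  \int[Q]_q `|bias_above (empirical R s) q - bias_above J q| <= e / 4 ->
  `|l1_ATB (empirical R s) - l1_ATB J| <= e /\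
  `|ATB (empirical R s) - ATB J| <= e.
Proof.
move=> J01 n0 s01.
have mbJ : measurable_fun setT (bias_below J).
  exact: (measurable_masked_bias J01 mbelow).
have maJ : measurable_fun setT (bias_above J).
  exact: (measurable_masked_bias J01 mabove).
have mbS : measurable_fun setT (bias_below (empirical R s)).
  exact: (measurable_masked_bias_empirical s mbelow).
have maS : measurable_fun setT (bias_above (empirical R s)).
  exact: (measurable_masked_bias_empirical s mabove).
have bJ1 q : `|bias_below J q| <= 1 by exact: (masked_bias_le1 J01 mbelow).
have aJ1 q : `|bias_above J q| <= 1 by exact: (masked_bias_le1 J01 mabove).
have bS1 q : `|bias_below (empirical R s) q| <= 1.
  exact: (masked_bias_empirical_le1 mbelow s01).
have aS1 q : `|bias_above (empirical R s) q| <= 1.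
  exact: (masked_bias_empirical_le1 mabove s01).
have sub2 (x y : R) : `|x| <= 1 -> `|y| <= 1 -> `|x - y| <= 2.
  by move=> x1 y1; rewrite (le_trans (ler_normB _ _))//; lra.
have add2 (x y : R) : `|x| <= 1 -> `|y| <= 1 -> `| `|x| + `|y| | <= 2.
  by move=> x1 y1; rewrite ger0_norm ?addr_ge0//; lra.
have sqr1 (x : R) : `|x| <= 1 -> x ^+ 2 <= 1.
  by move=> x1; rewrite -real_normK ?num_real// expr_le1.
have addsqr2 (x y : R) : `|x| <= 1 -> `|y| <= 1 -> `|x ^+ 2 + y ^+ 2| <= 2.
  move=> /sqr1 x1 /sqr1 y1; rewrite ger0_norm ?addr_ge0 ?sqr_ge0//; lra.
have sqr_lip (x y : R) : `|x| <= 1 -> `|y| <= 1 ->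
    `|x ^+ 2 - y ^+ 2| <= 2 * `|x - y|.
  move=> x1 y1; rewrite subr_sqr normrM mulrC ler_wpM2r//.
  by rewrite (le_trans (ler_normD _ _))//; lra.
move=> be ae; split;
  apply: (@Rintegral_dist_le _ _ _ Q _ _
    (fun q => bias_below (empirical R s) q - bias_below J q)
    (fun q => bias_above (empirical R s) q - bias_above J q) 2) => //.
- by apply: measurable_funD; exact: measurableT_comp.
- by apply: measurable_funD; exact: measurableT_comp.
- exact: measurable_funB.
- exact: measurable_funB.
- by move=> q; exact: add2.
- by move=> q; exact: add2.
- by move=> q; exact: sub2.
- by move=> q; exact: sub2.
- move=> q; rewrite opprD addrACA (le_trans (ler_normD _ _))//.
  have := ler_dist_dist (bias_below (empirical R s) q) (bias_below J q).
  have := ler_dist_dist (bias_above (empirical R s) q) (bias_above J q).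
  have := normr_ge0 (bias_below (empirical R s) q - bias_below J q).
  have := normr_ge0 (bias_above (empirical R s) q - bias_above J q).
  lra.
- by apply: measurable_funD; exact: measurable_funX.
- by apply: measurable_funD; exact: measurable_funX.
- exact: measurable_funB.
- exact: measurable_funB.
- by move=> q; exact: addsqr2.
- by move=> q; exact: addsqr2.
- by move=> q; exact: sub2.
- by move=> q; exact: sub2.
- move=> q; rewrite opprD addrACA (le_trans (ler_normD _ _))// lerD//;
  exact: sqr_lip.
Qed.

Context (J : probability (R * bool)%type R) d (Omega : measurableType d)
  (P : probability Omega R) (n : nat)
  (X : 'I_n -> {RV P >-> (R * bool)%type}).
Hypotheses (J01 : prediction_state_distribution J) (iidX : iid_sample J X)
  (n0 : (0 < n)%N).

Let sample (w : Omega) (i : 'I_n) : R * bool := X i w.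

(** Joint measurability lets Tonelli show that the empirical functionals are random variables. *)
Let mbias_joint c : measurable_fun setT c -> measurable_fun [set: Omega * R]
  (fun u => masked_bias c (empirical R (sample u.1)) u.2).
Proof.
move=> mc; rewrite (_ : (fun _ => _) =
    fun u => n%:R^-1 *
      \sum_(i < n) masked_residual c (X i u.1, u.2)); last first.
  by apply/funext => u; exact: masked_bias_empirical.
apply: measurable_funM => //; apply: measurable_sum => i.
apply: (measurableT_comp (measurable_masked_residual mc)).
by apply: measurable_fun_pair => //=; exact: measurableT_comp.
Qed.

Lemma measurable_ATB_empirical :
  measurable_fun setT (fun w => ATB (empirical R (sample w))).
Proof.
apply: measurableT_comp => //.
apply: (@measurable_fun_fubini_tonelli_F _ _ _ _ _ Q (fun u =>
  (bias_below (empirical R (sample u.1)) u.2 ^+ 2 +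
   bias_above (empirical R (sample u.1)) u.2 ^+ 2)%:E)).
  apply/measurable_EFinP; apply: measurable_funD; apply: measurable_funX.
    exact: (mbias_joint mbelow).
  exact: (mbias_joint mabove).
by move=> u; rewrite lee_fin addr_ge0// sqr_ge0.
Qed.

Lemma measurable_l1_ATB_empirical :
  measurable_fun setT (fun w => l1_ATB (empirical R (sample w))).
Proof.
apply: measurableT_comp => //.
apply: (@measurable_fun_fubini_tonelli_F _ _ _ _ _ Q (fun u =>
  (`|bias_below (empirical R (sample u.1)) u.2| +
   `|bias_above (empirical R (sample u.1)) u.2|)%:E)).
  apply/measurable_EFinP; apply: measurable_funD; apply: measurableT_comp => //.
    exact: (mbias_joint mbelow).
  exact: (mbias_joint mabove).
by move=> u; rewrite lee_fin addr_ge0.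
Qed.

(** The exceptional event is defined through the unit-masked residual, whose terms are bounded
    everywhere; for samples in [0,1] it speaks of the original bias. *)
Lemma bias_deviation_tail c t : measurable_fun setT c -> 0 <= t <= 4 ->
  exists B, [/\ measurable B,
    (P B <= (2 * expR (- (n%:R * t ^+ 2 / 32)))%:E)%E &
    forall w, (forall i, 0 <= (X i w).1 <= 1) -> ~ B w ->
      \int[Q]_q `|masked_bias c (empirical R (sample w)) q - masked_bias c J q|
      <= t].
Proof.
move=> mc t04.
have mf : measurable_fun setT (masked_residual (unit_mask c)).
  by apply: measurable_masked_residual; exact: measurable_unit_mask.
have f1 := @masked_residual_unit_le1 R c.
pose f := masked_residual (unit_mask c).
exists [set w | t < \int[Q]_q `|n%:R^-1 *
  \sum_(i < n) (f (X i w, q) - \int[J]_z f (z, q))|]; split; last 1 first.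
- move=> w Xw01 /negP; rewrite -leNgt; apply: le_trans.
  rewrite le_eqVlt; apply/orP; left; apply/eqP; apply: eq_Rintegral => q _.
  rewrite masked_bias_empirical_unit// masked_bias_unit//.
  rewrite sumrB mulrBr sumr_const card_ord; congr (`|_ - _|).
  by rewrite -[X in _ = _ * X]mulr_natl mulKf// pnatr_eq0 -lt0n.
- rewrite -[X in measurable X]setTI; apply: measurable_fun_ltr => //.
  exact: (measurable_integrated_deviation J Q mf f1 X).
- exact: (integrated_deviation_tail Q mf f1 iidX n0 t04).
Qed.

(** Each point lies in [0,1] with probability 1 since its law is [J], and independence turns the
    joint event into a product of ones. *)
Lemma sample_unit_probability1 :
  exists G, [/\ measurable G, P G = 1%E &
    forall w, G w -> forall i, 0 <= (X i w).1 <= 1].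
Proof.
have mU := @measurable_unit_predictions R.
exists (\bigcap_(i in [set` [set: 'I_n]%SET])
  (X i @^-1` [set p : R * bool | 0 <= p.1 <= 1])); split.
- apply: fin_bigcap_measurable => // i _.
  by rewrite -[_ @^-1` _]setTI; exact: measurable_funP.
- rewrite iidX.1// big1// => i _.
  by have := iidX.2 i _ mU; rewrite J01.
- by move=> w Gw i; apply: Gw; rewrite /= inE.
Qed.

End ATB_deviation.

(** * Choice of the constant and union bound *)

Theorem theorem4p10 (R : realType) :
  exists C : R, 0 < C /\
  forall (J : probability (R * bool)%type R) (eps delta : R) (T : nat)
    (d : measure_display) (Omega : measurableType d) (P : probability Omega R)
    (X : 'I_T -> {RV P >-> (R * bool)%type}),
  prediction_state_distribution J ->
  0 < eps < 1 / 3 ->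
  0 < delta < 1 / 3 ->
  C * eps ^- 2 * ln (1 / delta) < T%:R ->
  iid_sample J X ->
  ((1 - delta)%:E <=
   P [set w |
        (`|l1_ATB (empirical R (fun i => X i w)) - l1_ATB J| <= eps)%R /\
        (`|ATB (empirical R (fun i => X i w)) - ATB J| <= eps)%R])%E.
Proof.
(* The tail bound 2 exp(- T (eps/4)^2 / 32) is below 2 delta^3 <= delta / 2. *)
exists (3 * 32 * 4 ^+ 2); split; first by rewrite !mulr_gt0// exprn_gt0.
move=> J eps delta T d Omega P X J01 /andP[e0 e3] /andP[d0 d3].
move=> TC iidX.
have lnd : ln (1 / delta) = - ln delta by rewrite div1r lnV// posrE.
have lnd0 : ln delta < 0 by apply: ln_lt0; rewrite d0/=; lra.
have T0 : (0 < T)%N.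
  rewrite -(ltr0n R); apply: le_lt_trans TC.
  by rewrite !mulr_ge0 ?exprn_ge0 ?invr_ge0 ?sqr_ge0// lnd oppr_ge0 ltW.
have t04 : 0 <= eps / 4 <= 4 by apply/andP; split; lra.
have tail : 2 * expR (- (T%:R * (eps / 4) ^+ 2 / 32)) <= delta / 2.
  (* In the constant, 32 and [4 ^+ 2] cancel the denominators of the tail exponent at [eps / 4], and
     3 becomes the power of [delta]. *)
  have TE : - (T%:R * (eps / 4) ^+ 2 / 32) <= 3%:R * ln delta.
    move: TC; rewrite lnd mulrAC ltr_pdivrMr ?exprn_gt0// => TC.
    rewrite expr_div_n; lra.
  have : expR (- (T%:R * (eps / 4) ^+ 2 / 32)) <= delta ^+ 3.
    by apply: (@le_trans _ _ (expR (3%:R * ln delta)));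
      rewrite ?ler_expR// expRM_natl lnK// posrE.
  have : delta ^+ 2 <= 1 / 9.
    have := ler_pM (ltW d0) (ltW d0) (ltW d3) (ltW d3); rewrite -expr2; lra.
  move=> /(ler_wpM2l (ltW d0)); rewrite -exprS; lra.
have [G [mG PG G01]] := sample_unit_probability1 J01 iidX.
have mb : measurable_fun setT (fun u : (R * bool) * R => u.1.1 < u.2).
  by apply: measurable_fun_ltr => //; exact: measurableT_comp.
have ma : measurable_fun setT (fun u : (R * bool) * R => u.2 <= u.1.1).
  by apply: measurable_fun_ler => //; exact: measurableT_comp.
have [Bb [mBb PBb Bbw]] := bias_deviation_tail J01 iidX T0 mb t04.
have [Ba [mBa PBa Baw]] := bias_deviation_tail J01 iidX T0 ma t04.
set E := [set w | _].
have mE : measurable E.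
  have mball (f : Omega -> R) (x : R) : measurable_fun setT f ->
      measurable [set w | `|f w - x| <= eps].
    move=> mf; rewrite -[X in measurable X]setTI.
    apply: measurable_fun_ler => //; apply: measurableT_comp => //.
    exact: measurable_funB.
  apply: measurableI; apply: mball.
    exact: measurable_l1_ATB_empirical.
  exact: measurable_ATB_empirical.
(* Since [P G = 1], subadditivity gives [1 <= P E + P (Bb U Ba)], where each bad event costs at most
   [delta / 2]. *)
have GEB : G `<=` E `|` (Bb `|` Ba).
  move=> w Gw; have [|nB] := pselect ((Bb `|` Ba) w); first by right.
  left; apply: ATB_deviation_le => //; first exact: G01.
  - by apply: (Bbw w (G01 w Gw)) => wB; apply: nB; left.
  - by apply: (Baw w (G01 w Gw)) => wB; apply: nB; right.
have mB : measurable (Bb `|` Ba) by exact: measurableU.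
have PB : (P (Bb `|` Ba) <= delta%:E)%E.
  apply: (le_trans (measureU2 _ mBb mBa)).
  rewrite [in leRHS](splitr delta) EFinD leeD//.
    by apply: le_trans PBb _; rewrite lee_fin.
  by apply: le_trans PBa _; rewrite lee_fin.
rewrite EFinB leeBlDr//.
apply: le_trans (leeD2l _ PB); apply: le_trans (measureU2 _ mE mB).
by rewrite -PG le_measure ?inE//; exact: measurableU.
Qed.
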